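(* Let $f: X\to\mathbb{R}$ be a continuous function on an open neighborhood $X\subset\mathbb{R}$ of $\{\lambda_1,\ldots,\lambda_n\}$ with $f(\lambda_i)\ne0$ for all $i$, let $F:\mathcal{T}_\Lambda\to\mathcal{T}_\Lambda$ be the $QR$ step induced by $f$, let $\pi\in S_n$, and let $F^{\phi_\pi} = \phi_\pi^{-1}\circ F\circ\phi_\pi:\mathbb{R}^{n-1}\to\mathbb{R}^{n-1}$. Then $$F^{\phi_\pi}(\beta^\pi_1,\ldots,\beta^\pi_{n-1}) = \left(\left|\frac{f(\lambda_{\pi(2)})}{f(\lambda_{\pi(1)})}\right|\beta^\pi_1,\ldots,\left|\frac{f(\lambda_{\pi(n)})}{f(\lambda_{\pi(n-1)})}\right|\beta^\pi_{n-1}\right).$$ Moreover, if $T\in\mathcal{U}^\pi_\Lambda$ has $\pi$-bidiagonal coordinates $(\beta^\pi_1,\ldots,\beta^\pi_{n-1})$ and $$|f(\lambda_{\pi(1)})|>|f(\lambda_{\pi(2)})|>\cdots>|f(\lambda_{\pi(n)})|,$$ then $\lim_{k\to+\infty}F^k(T)=\Lambda^\pi$ with asymptotics, for $i = 1,\ldots,n-1$, $$\beta^\pi_i = \lim_{k\to+\infty}(F^k(T))_{i+1,i}\left|\frac{f(\lambda_{\pi(i)})}{f(\lambda_{\pi(i+1)})}\right|^k.$$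
   Context: Fix real numbers $\lambda_1 < \cdots < \lambda_n$ ($n\ge2$) and $\Lambda = \operatorname{diag}(\lambda_1,\ldots,\lambda_n)$. Let $\mathcal{T}_\Lambda$ be the set of real symmetric tridiagonal $n\times n$ matrices conjugate to $\Lambda$, a compact smooth submanifold of the space of real symmetric tridiagonal matrices. $Q^*$ denotes the transpose and $O(n)$ the real orthogonal group. For invertible real $M$, $M = \mathbf{Q}(M)\mathbf{R}(M)$ is the unique $QR$ factorization with $\mathbf{Q}(M)\in O(n)$ and $\mathbf{R}(M)$ upper triangular with positive diagonal. A matrix $M$ is $LU$-positive if it admits a (unique) factorization $M = LU$ with $L=\mathbf{L}(M)$ lower triangular with unit diagonal and $U$ upper triangular with positive diagonal entries. For $\pi \in S_n$, let $\lambda^\pi_i=\lambda_{\pi(i)}$ and $\Lambda^\pi = \operatorname{diag}(\lambda^\pi_1,\ldots,\lambda^\pi_n)$. The chart domain $\mathcal{U}^\pi_\Lambda\subset\mathcal{T}_\Lambda$ is the open set of $T\in\mathcal{T}_\Lambda$ for which there is a (necessarily unique) $LU$-positive $Q_\pi\in O(n)$ with $T = Q_\pi^*\Lambda^\pi Q_\pi$. For such $T$ let $L_\pi=\mathbf{L}(Q_\pi)$ and $B_\pi=L_\pi^{-1}\Lambda^\pi L_\pi$; this matrix is lower bidiagonal with diagonal entries $\lambda^\pi_1,\ldots,\lambda^\pi_n$, and its subdiagonal entries $\beta^\pi_i=(B_\pi)_{i+1,i}$ are the $\pi$-bidiagonal coordinates of $T$. The map $\psi_\pi:\mathcal{U}^\pi_\Lambda\to\mathbb{R}^{n-1}$,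 $\psi_\pi(T)=(\beta^\pi_1,\ldots,\beta^\pi_{n-1})$, is a diffeomorphism, with inverse $\phi_\pi:\mathbb{R}^{n-1}\to\mathcal{U}^\pi_\Lambda$ given by $\phi_\pi(\beta^\pi_1,\ldots,\beta^\pi_{n-1})=\mathbf{Q}(L_\pi)^*\Lambda^\pi\mathbf{Q}(L_\pi)$, where $L_\pi$ is the lower triangular matrix with unit diagonal such that $L_\pi^{-1}\Lambda^\pi L_\pi$ is the lower bidiagonal matrix with diagonal $(\lambda^\pi_i)$ and subdiagonal $(\beta^\pi_i)$. The $QR$ step induced by $f$ is the map $F:\mathcal{T}_\Lambda\to\mathcal{T}_\Lambda$, $F(T)=\mathbf{Q}(f(T))^*\,T\,\mathbf{Q}(f(T))$, with $f(T)$ defined by functional calculus; it is smooth and preserves each $\mathcal{U}^\pi_\Lambda$. $F^k$ denotes the $k$-th iterate of $F$. *)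

(* Defs.v *)
From HB Require Import structures.
From mathcomp Require Import all_boot all_order all_algebra all_fingroup.
From mathcomp Require Import all_classical all_reals all_analysis.

Set Implicit Arguments.
Unset Strict Implicit.
Unset Printing Implicit Defensive.

Import Order.TTheory GRing.Theory Num.Theory numFieldNormedType.Exports.
Local Open Scope classical_set_scope.
Local Open Scope ring_scope.

(* Objects that are unique when they exist (matrix factors, f(T), ...) are
   picked with [xget 0]; the junk value 0 occurs only when none exists. *)

Section QRLU.
Variables (R : realType) (n : nat).
Implicit Types (M Q L U T : 'M[R]_n).

Definition orthogonal_mx Q : Prop := Q^T *m Q = 1%:M.

Definition upper_pos_mx U : Prop :=
  is_trig_mx U^T /\ (forall i, 0 < U i i).

Definition lower_unit_mx L : Prop :=
  is_trig_mx L /\ (forall i, L i i = 1).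

Definition Qfactor M : 'M[R]_n :=
  xget 0 [set Q | orthogonal_mx Q /\
                  exists U, upper_pos_mx U /\ M = Q *m U].

Definition is_Lfactor M L : Prop :=
  lower_unit_mx L /\ exists U, upper_pos_mx U /\ M = L *m U.

Definition LU_positive M : Prop := exists L, is_Lfactor M L.

Definition Lfactor M : 'M[R]_n := xget 0 [set L | is_Lfactor M L].

(* f(T) for T = Q^* diag(d) Q symmetric is Q^* diag(f(d)) Q; only the values
   of f on the spectrum of T matter. *)
Definition funcalc (f : R -> R) T : 'M[R]_n :=
  xget 0 [set M | exists (Q : 'M[R]_n) (d : 'rV[R]_n),
    [/\ orthogonal_mx Q, T = Q^T *m diag_mx d *m Q &
        M = Q^T *m diag_mx (map_mx f d) *m Q]].

Definition QRstep (f : R -> R) T : 'M[R]_n :=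
  (Qfactor (funcalc f T))^T *m T *m Qfactor (funcalc f T).

Definition tridiagonal_mx T : Prop :=
  forall i j : 'I_n, ((i.+1 < j) || (j.+1 < i))%N -> T i j = 0.

Definition permdiag (lambda : 'I_n -> R) (p : 'S_n) : 'M[R]_n :=
  diag_mx (\row_i lambda (p i)).

Definition isospectral (lambda : 'I_n -> R) : set 'M[R]_n :=
  [set T | [/\ T^T = T, tridiagonal_mx T &
    exists2 P : 'M[R]_n, P \in unitmx &
      T = invmx P *m diag_mx (\row_i lambda i) *m P]].

Definition is_Qpi (lambda : 'I_n -> R) (p : 'S_n) T Q : Prop :=
  [/\ orthogonal_mx Q, LU_positive Q & T = Q^T *m permdiag lambda p *m Q].

Definition chart_domain (lambda : 'I_n -> R) (p : 'S_n) : set 'M[R]_n :=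
  [set T | isospectral lambda T /\ exists Q, is_Qpi lambda p T Q].

Definition Qpi (lambda : 'I_n -> R) (p : 'S_n) T : 'M[R]_n :=
  xget 0 [set Q | is_Qpi lambda p T Q].

Definition Bpi (lambda : 'I_n -> R) (p : 'S_n) T : 'M[R]_n :=
  invmx (Lfactor (Qpi lambda p T)) *m permdiag lambda p
    *m Lfactor (Qpi lambda p T).

End QRLU.

(* For matrices of size n.+1, the n subdiagonal positions are indexed by
   i : 'I_n, whose values are sent to i and i + 1 in 'I_n.+1. *)
Definition ord_lo n (i : 'I_n) : 'I_n.+1 := widen_ord (leqnSn n) i.
Definition ord_hi n (i : 'I_n) : 'I_n.+1 := lift ord0 i.

Section Charts.
Variables (R : realType) (n : nat).
Variables (lambda : 'I_n.+1 -> R) (p : 'S_n.+1).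

Definition psi (T : 'M[R]_n.+1) : 'rV[R]_n :=
  \row_i Bpi lambda p T (ord_hi i) (ord_lo i).

Definition bidiag (beta : 'rV[R]_n) : 'M[R]_n.+1 :=
  permdiag lambda p +
  \sum_(i < n) beta 0 i *: delta_mx (ord_hi i) (ord_lo i).

Definition Lpi (beta : 'rV[R]_n) : 'M[R]_n.+1 :=
  xget 0 [set L | lower_unit_mx L /\
                  invmx L *m permdiag lambda p *m L = bidiag beta].

Definition phi (beta : 'rV[R]_n) : 'M[R]_n.+1 :=
  (Qfactor (Lpi beta))^T *m permdiag lambda p *m Qfactor (Lpi beta).

(* [psi] is the inverse of [phi] on [chart_domain lambda p]. *)
Definition QRstep_chart (f : R -> R) : 'rV[R]_n -> 'rV[R]_n :=
  psi \o QRstep f \o phi.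

End Charts.

(* Main.v *)
Require Import Defs.
From HB Require Import structures.
From mathcomp Require Import all_boot all_order all_algebra all_fingroup.
From mathcomp Require Import all_classical all_reals all_analysis.
From mathcomp Require Import ring.

Set Implicit Arguments.
Unset Strict Implicit.
Unset Printing Implicit Defensive.

Import Order.TTheory GRing.Theory Num.Theory numFieldNormedType.Exports.
Local Open Scope classical_set_scope.
Local Open Scope ring_scope.

(** Write [d i = lambda (p i)], [D = diag(d)] and [B] for the bidiagonal matrix
    of the coordinates [beta].  The argument is carried by the lower unipotent
    matrix [L] with [D L = L B].  As the [d i] are distinct, [B] determines [L]
    ([intertwine_unique], [intertwine_exists]), and [phi beta] is [Q^T D Q] for
    the orthogonal factor of [L = Q U].  Conversely, an LU-positive [Q]
    conjugating [D] to [T] is unique ([Qpi_unique]) and is the orthogonal factor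
    of its own [L]; hence [psi] and [phi] are mutually inverse ([psi_phi],
    [phi_psi]).

    In terms of [L], the QR step induced by [f] is conjugation by the positive
    diagonal matrix [E = |f(D)|]: the QR factorization of [E L E^-1] gives the
    one of [f(T)], the signs of [f(D)] being absorbed by the orthogonal factor
    ([QRstep_phi]).  Since [E] commutes with [D], replacing [L] by [E L E^-1]
    replaces [B] by [E B E^-1], whose subdiagonal entries are multiplied by the
    ratios of consecutive entries of [E]; this is the formula for the step in
    coordinates.

    Thus [k] steps replace [L] by [E^k L E^-k].  When the entries of [E]
    decrease, this matrix tends to the identity ([cvg_scale_mx]), and so do its
    factors [Q_k] and [U_k] ([cvg_QR1]); therefore [Q_k^T D Q_k] tends to [D].
    Moreover [T U = U B] gives exactly
    [T (i + 1) i = (U (i + 1) (i + 1) / U i i) * beta i] ([phi_sub]); along the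
    iteration the power of the ratio cancels the one in the coordinate and the
    quotient of diagonal entries of [U_k] tends to [1]. *)

(** * Triangular matrices *)

Section Triangular.
Variables (F : fieldType) (n : nat).
Implicit Types A B : 'M[F]_n.

Lemma mul_trig A B : is_trig_mx A -> is_trig_mx B -> is_trig_mx (A *m B).
Proof.
move=> /is_trig_mxP tA /is_trig_mxP tB; apply/is_trig_mxP => i j ij.
rewrite mxE big1 // => k _.
have [ik|ki] := ltnP i k; first by rewrite tA ?mul0r.
by rewrite tB ?mulr0 // (leq_ltn_trans ki).
Qed.

Lemma mul_trig_diag A B i :
  is_trig_mx A -> is_trig_mx B -> (A *m B) i i = A i i * B i i.
Proof.
move=> /is_trig_mxP tA /is_trig_mxP tB.
rewrite mxE (bigD1 i) //= big1 ?addr0 // => k ki.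
have [ik|ik|ik] := ltngtP i k; first by rewrite tA ?mul0r.
  by rewrite tB ?mulr0.
by rewrite (val_inj ik) eqxx in ki.
Qed.

Lemma trig_unitmx A :
  is_trig_mx A -> (forall i, A i i != 0) -> A \in unitmx.
Proof.
by move=> tA A0; rewrite unitmxE unitfE det_trig //; apply/prodf_neq0.
Qed.

Lemma inv_trig A :
  is_trig_mx A -> (forall i, A i i != 0) -> is_trig_mx (invmx A).
Proof.
move=> tA A0; have uA := trig_unitmx tA A0; have /is_trig_mxP tA' := tA.
apply/is_trig_mxP => i; have [m] := ubnP (val i).
elim: m i => // m IH i im j ij.
have : (A *m invmx A) i j = 0.
  by rewrite mulmxV // mxE; case: eqP ij => // ->; rewrite ltnn.
rewrite mxE (bigD1 i) //= big1 ?addr0.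
  by move=> /eqP; rewrite mulf_eq0 (negPf (A0 i)) => /eqP.
move=> k ki; have [ik|ik|ik] := ltngtP i k; first by rewrite tA' ?mul0r.
  by rewrite IH ?mulr0 ?(ltn_trans ik ij) // (leq_trans ik).
by rewrite (val_inj ik) eqxx in ki.
Qed.

Lemma inv_trig_diag A i :
  is_trig_mx A -> (forall i, A i i != 0) -> (invmx A) i i = (A i i)^-1.
Proof.
move=> tA A0; apply: (mulfI (A0 i)); rewrite mulfV //.
rewrite -mul_trig_diag ?inv_trig // mulmxV ?trig_unitmx //.
by rewrite mxE eqxx.
Qed.

End Triangular.

Section Factors.
Variables (R : realType) (n : nat).
Implicit Types (L M Q U : 'M[R]_n).

Lemma upper_pos_neq0 U i : upper_pos_mx U -> U^T i i != 0.
Proof. by case=> _ /(_ i); rewrite mxE => /lt0r_neq0. Qed.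

Lemma upper_pos_unitmx U : upper_pos_mx U -> U \in unitmx.
Proof.
move=> pU; rewrite -unitmx_tr; apply: trig_unitmx; first by case: pU.
by move=> i; exact: upper_pos_neq0.
Qed.

Lemma upper_pos_eq0 U (i j : 'I_n) : upper_pos_mx U -> (j < i)%N -> U i j = 0.
Proof. by case=> /is_trig_mxP tU _ /tU; rewrite mxE. Qed.

Lemma upper_posM U1 U2 :
  upper_pos_mx U1 -> upper_pos_mx U2 -> upper_pos_mx (U1 *m U2).
Proof.
move=> [t1 p1] [t2 p2]; split; first by rewrite trmx_mul mul_trig.
move=> i; have -> : (U1 *m U2) i i = (U2^T *m U1^T) i i.
  by rewrite -trmx_mul [RHS]mxE.
by rewrite mul_trig_diag // !mxE mulr_gt0.
Qed.

Lemma upper_posV U : upper_pos_mx U -> upper_pos_mx (invmx U).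
Proof.
move=> pU; have U0 i := upper_pos_neq0 i pU; case: (pU) => tU gU.
split; first by rewrite trmx_inv inv_trig.
move=> i; have -> : invmx U i i = invmx U^T i i by rewrite -trmx_inv [RHS]mxE.
by rewrite inv_trig_diag // mxE invr_gt0.
Qed.

Lemma upper_pos_diag (e : 'rV[R]_n) :
  (forall i, 0 < e 0 i) -> upper_pos_mx (diag_mx e).
Proof.
move=> e0; split; first by rewrite tr_diag_mx diag_mx_is_trig.
by move=> i; rewrite mxE eqxx mulr1n.
Qed.

Lemma lower_unit_neq0 L i : lower_unit_mx L -> L i i != 0.
Proof. by case=> _ ->; exact: oner_neq0. Qed.

Lemma lower_unit_unitmx L : lower_unit_mx L -> L \in unitmx.
Proof.
by move=> uL; apply: trig_unitmx => [|i]; [case: uL|exact: lower_unit_neq0].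
Qed.

(** Uniqueness of the LU factorization up to a diagonal [s]: comparing the two
    sides of [L2^-1 S L1 = U2 U1^-1], the first is lower triangular with
    diagonal [s] and the second upper triangular with positive diagonal. *)
Lemma LU_sign (s : 'rV[R]_n) L1 L2 U1 U2 :
  lower_unit_mx L1 -> lower_unit_mx L2 -> upper_pos_mx U1 -> upper_pos_mx U2 ->
  diag_mx s *m L1 *m U1 = L2 *m U2 ->
  (forall i, 0 < s 0 i) /\ diag_mx s *m U1 = U2.
Proof.
move=> l1 l2 u1 u2 E.
have iL2 := lower_unit_unitmx l2; have iU1 := upper_pos_unitmx u1.
have [t1 d1] := l1; have [t2 d2] := l2.
have L20 i := lower_unit_neq0 i l2.
have {E}E : invmx L2 *m (diag_mx s *m L1) = U2 *m invmx U1.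
  by apply: (canRL (mulmxK iU1)); rewrite -mulmxA E mulKmx.
have tW : is_trig_mx (invmx L2 *m (diag_mx s *m L1)).
  by rewrite mul_trig ?inv_trig ?mul_trig ?diag_mx_is_trig.
have dW i : (invmx L2 *m (diag_mx s *m L1)) i i = s 0 i.
  rewrite mul_trig_diag ?inv_trig ?mul_trig ?diag_mx_is_trig //.
  by rewrite inv_trig_diag // mul_diag_mx mxE d1 d2 invr1 mul1r mulr1.
have pW : upper_pos_mx (U2 *m invmx U1) by exact/upper_posM/upper_posV.
split=> [i|]; first by rewrite -dW E; case: pW.
rewrite -[RHS](mulmxKV iU1) -E; congr (_ *m _).
apply/matrixP => i j; have [ij|ij|/val_inj <-] := ltngtP i j.
- by rewrite (is_trig_mxP tW) // mxE; case: eqP ij => // ->; rewrite ltnn.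
- rewrite E [RHS]upper_pos_eq0 // mxE.
  by case: eqP ij => // ->; rewrite ltnn.
- by rewrite dW mxE eqxx.
Qed.

Lemma Lfactor_eq L U :
  lower_unit_mx L -> upper_pos_mx U -> Lfactor (L *m U) = L.
Proof.
move=> lL pU; apply: xget_unique; first by split=> //; exists U.
move=> L' [lL' [U' [pU' E]]].
have [] := @LU_sign (const_mx 1) L L' U U' lL lL' pU pU'.
  by rewrite diag_const_mx mul1mx.
rewrite diag_const_mx mul1mx => _ UU'.
by move: E; rewrite -UU' => /(can_inj (mulmxK (upper_pos_unitmx pU))).
Qed.

Lemma orthogonal_mxV Q : orthogonal_mx Q -> Q *m Q^T = 1%:M.
Proof. exact: mulmx1C. Qed.

Lemma orthogonal_mxM Q1 Q2 :
  orthogonal_mx Q1 -> orthogonal_mx Q2 -> orthogonal_mx (Q1 *m Q2).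
Proof.
rewrite /orthogonal_mx => o1 o2.
by rewrite trmx_mul mulmxA -(mulmxA _ Q1^T) o1 mulmx1.
Qed.

Lemma orthogonal_mxT Q : orthogonal_mx Q -> orthogonal_mx Q^T.
Proof. by move=> oQ; rewrite /orthogonal_mx trmxK orthogonal_mxV. Qed.

Lemma orthogonal_entry_le1 Q i j : orthogonal_mx Q -> `|Q i j| <= 1.
Proof.
move=> oQ; rewrite -ler_sqr ?nnegrE // real_normK ?num_real // expr1n.
have <- : (Q^T *m Q) j j = 1 by rewrite oQ mxE eqxx.
rewrite mxE (bigD1 i) //= mxE -expr2 lerDl sumr_ge0 // => k _.
by rewrite mxE -expr2 sqr_ge0.
Qed.

(** The inverse of an orthogonal upper triangular [W] is its transpose, so [W]
    is also lower triangular; then [W i i ^+ 2 = 1] and positivity leaves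
    [W i i = 1]. *)
Lemma orthogonal_upper_pos_eq1 U :
  orthogonal_mx U -> upper_pos_mx U -> U = 1%:M.
Proof.
move=> oU pU; have [tU gU] := pU.
have iU : invmx U = U^T.
  by rewrite -[RHS](mulmxK (upper_pos_unitmx pU)) oU mul1mx.
have [tV _] := upper_posV pU; rewrite iU trmxK in tV.
apply/matrixP => i j; have [ij|ij|/val_inj <-] := ltngtP i j.
- by rewrite (is_trig_mxP tV) // mxE; case: eqP ij => // ->; rewrite ltnn.
- rewrite upper_pos_eq0 // mxE.
  by case: eqP ij => // ->; rewrite ltnn.
- have : (U^T *m U) i i = 1 by rewrite oU mxE eqxx.
  rewrite mul_trig_diag // mxE => /eqP; rewrite -expr2 sqrf_eq1 => /orP[]/eqP U1.
    by rewrite U1 mxE eqxx.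
  by have := gU i; rewrite U1 ltr0N1.
Qed.

Lemma Qfactor_eq Q U :
  orthogonal_mx Q -> upper_pos_mx U -> Qfactor (Q *m U) = Q.
Proof.
move=> oQ pU; apply: xget_unique; first by split=> //; exists U.
move=> Q' [oQ' [U' [pU' E]]].
have iU := upper_pos_unitmx pU.
have E' : Q'^T *m Q = U' *m invmx U.
  by rewrite -(mulmxK iU Q) E !mulmxA oQ' mul1mx.
have : Q'^T *m Q = 1%:M.
  apply: orthogonal_upper_pos_eq1; first exact/orthogonal_mxM/oQ/orthogonal_mxT.
  by rewrite E'; exact/upper_posM/upper_posV.
by move=> E1; rewrite -[LHS]mulmx1 -E1 mulmxA orthogonal_mxV // mul1mx.
Qed.

End Factors.

(** * Existence of the QR factorization *)

(** Cholesky factorization, by induction on the size: clearing the first row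
    and column by the unipotent congruence [P] leaves the Schur complement [C']
    of the corner [a], and a congruence preserves positivity of the form. *)
Lemma cholesky (R : realType) n (S : 'M[R]_n) :
  S^T = S -> (forall v : 'cV_n, v != 0 -> 0 < (v^T *m S *m v) 0 0) ->
  exists2 U : 'M[R]_n, upper_pos_mx U & S = U^T *m U.
Proof.
elim: n S => [|n IH] S symS posS.
  exists 0; last by apply/matrixP => -[].
  by split=> [|[]//]; apply/is_trig_mxP => -[].
move: S symS posS; rewrite -[n.+1]/(1 + n)%N => S symS posS.
pose a := ulsubmx S 0 0; pose b := ursubmx S; pose C := drsubmx S.
have SE : S = block_mx a%:M b b^T C.
  by rewrite /b trmx_ursub symS -mx11_scalar submxK.
have symC : C^T = C by rewrite /C trmx_drsub symS.
have a0 : 0 < a.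
  have := posS (col_mx 1%:M 0); rewrite {1}SE -mulmxA mul_block_col tr_col_mx.
  rewrite mul_row_col trmx0 !mulmx0 !mul0mx !addr0 trmx1 mul1mx mulmx1 !mxE.
  apply; apply/eqP => /matrixP /(_ (lshift n 0) 0); rewrite col_mxEu !mxE.
  by apply/eqP; exact: oner_neq0.
have upper_block (r : R) (B : 'rV[R]_n) (V : 'M[R]_n) :
    0 < r -> upper_pos_mx V -> upper_pos_mx (block_mx r%:M B 0 V).
  move=> r0 [tV gV]; split=> [|i].
    rewrite tr_block_mx trmx0; apply/is_trig_mxP => i j.
    case: (split_ordP i) => i' ->; case: (split_ordP j) => j' -> /=.
    - by rewrite !ord1.
    - by rewrite block_mxEur mxE.
    - by rewrite ord1.
    - by rewrite block_mxEdr ltn_add2l => /(is_trig_mxP tV).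
  case: (split_ordP i) => i' ->; last by rewrite block_mxEdr.
  by rewrite block_mxEul ord1 mxE.
pose P : 'M[R]_(1 + n) := block_mx 1%:M (a^-1 *: b) 0 1%:M.
pose C' := C - a^-1 *: (b^T *m b).
have pP : upper_pos_mx P.
  apply: upper_block => //; split; first by rewrite trmx1 scalar_mx_is_trig.
  by move=> i; rewrite mxE eqxx.
have {}SE : S = P^T *m block_mx a%:M 0 0 C' *m P.
  rewrite {1}SE tr_block_mx !mulmx_block !trmx1 trmx0.
  rewrite !(mulmx0, mul0mx, mul1mx, mulmx1, addr0, add0r) [(a^-1 *: b)^T]linearZ /=.
  have aV c (u : 'M[R]_(c, 1)) : (a^-1 *: u) *m a%:M = u.
    by rewrite mul_mx_scalar scalerA divff ?scale1r // gt_eqF.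
  rewrite aV mul_scalar_mx scalerA divff ?scale1r ?gt_eqF //.
  by rewrite -scalemxAr /C' addrC subrK.
have symC' : C'^T = C' by rewrite /C' linearB linearZ /= symC trmx_mul trmxK.
have [v v0|U' pU' C'E] := IH C' symC'.
  have uP := upper_pos_unitmx pP.
  have := posS (invmx P *m col_mx 0 v); rewrite {1}SE -!mulmxA mulKVmx //.
  rewrite trmx_mul -!mulmxA trmx_inv mulKmx ?unitmx_tr // mul_block_col.
  rewrite tr_col_mx mul_row_col trmx0 !(mul0mx, add0r); apply.
  apply: contraNneq v0 => /(congr1 (mulmx P)).
  by rewrite mulKVmx // mulmx0 -col_mx0 => /eq_col_mx[_ ->].
exists (block_mx (Num.sqrt a)%:M 0 0 U' *m P).
  by apply: upper_posM => //; apply: upper_block => //; rewrite sqrtr_gt0.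
rewrite {1}SE trmx_mul -!mulmxA; congr (_ *m _); rewrite !mulmxA; congr (_ *m _).
rewrite tr_block_mx mulmx_block !trmx0 !(mulmx0, mul0mx, addr0, add0r) -C'E.
by rewrite tr_scalar_mx -scalar_mxM -expr2 sqr_sqrtr // ltW.
Qed.

Lemma QR_exists (R : realType) n (M : 'M[R]_n) : M \in unitmx ->
  exists Q U : 'M[R]_n, [/\ orthogonal_mx Q, upper_pos_mx U & M = Q *m U].
Proof.
move=> uM; have [||U pU E] := @cholesky R n (M^T *m M).
- by rewrite trmx_mul trmxK.
- move=> v v0; have Mv0 : M *m v != 0.
    by apply: contraNneq v0 => /(congr1 (mulmx (invmx M))); rewrite mulKmx // mulmx0 => ->.
  have [i Mvi] : exists i, (M *m v) i 0 != 0.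
    apply/existsP; apply: contraNT Mv0; rewrite negb_exists => /forallP h.
    by apply/eqP/matrixP => i j; rewrite ord1 [RHS]mxE; apply/eqP; rewrite -[_ == _]negbK.
  have -> : v^T *m (M^T *m M) *m v = (M *m v)^T *m (M *m v).
    by rewrite trmx_mul !mulmxA.
  rewrite mxE (bigD1 i) //= mxE -expr2 ltr_wpDr ?exprn_even_gt0 //.
  by apply: sumr_ge0 => k _; rewrite mxE -expr2 sqr_ge0.
have uU := upper_pos_unitmx pU.
exists (M *m invmx U), U; split=> //; last by rewrite mulmxKV.
rewrite /orthogonal_mx trmx_mul !mulmxA -(mulmxA _ M^T) E trmx_inv !mulmxA.
by rewrite mulVmx ?unitmx_tr // mul1mx mulmxV.
Qed.

(** * Functional calculus *)

(** A matrix [W] with [diag(e') W = W diag(e)] relates only indices carrying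
    equal eigenvalues, so it also intertwines the diagonal matrices of the
    values of [f]; hence any orthogonal diagonalization computes [f(T)]. *)
Lemma funcalcE (R : realType) n (f : R -> R) (Q : 'M[R]_n) (e : 'rV[R]_n) :
  orthogonal_mx Q ->
  funcalc f (Q^T *m diag_mx e *m Q) = Q^T *m diag_mx (map_mx f e) *m Q.
Proof.
move=> oQ; apply: xget_unique; first by exists Q, e.
move=> _ [Q' [e' [oQ' E ->]]]; set W := Q' *m Q^T.
have eW : diag_mx e' *m W = W *m diag_mx e.
  have := congr1 (fun A => Q' *m A *m Q^T) E; rewrite /W /= !mulmxA.
  rewrite orthogonal_mxV // mul1mx -(mulmxA _ Q) orthogonal_mxV // mulmx1.
  by move=> ->.
have map_eV (V : 'M[R]_n) : diag_mx e' *m V = V *m diag_mx e ->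
    diag_mx (map_mx f e') *m V = V *m diag_mx (map_mx f e).
  rewrite !mul_diag_mx !mul_mx_diag => /matrixP eV.
  apply/matrixP => i j; have := eV i j; rewrite !mxE.
  have [->|V0] := eqVneq (V i j) 0; first by rewrite !mulr0 !mul0r.
  by rewrite [_ * e _ _]mulrC => /(mulIf V0) ->; rewrite mulrC.
have oW : orthogonal_mx W by exact/orthogonal_mxM/orthogonal_mxT.
have -> : Q' = W *m Q by rewrite /W -mulmxA oQ mulmx1.
move: W eW oW => W /map_eV eW oW.
rewrite trmx_mul -!mulmxA (mulmxA _ W) eW -mulmxA (mulmxA W^T) oW mul1mx.
by rewrite mulmxA.
Qed.

(** * Hessenberg matrices *)

Section Hessenberg.
Variables (R : realType) (n : nat).

Definition hessenberg_mx (H : 'M[R]_n) : Prop :=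
  forall i j : 'I_n, (j.+1 < i)%N -> H i j = 0.

Lemma upper_hessenberg (U H : 'M[R]_n) :
  upper_pos_mx U -> hessenberg_mx H -> hessenberg_mx (U *m H).
Proof.
move=> pU hH i j ji; rewrite mxE big1 // => k _.
have [ki|ik] := ltnP k i; first by rewrite upper_pos_eq0 ?mul0r.
by rewrite hH ?mulr0 // (leq_trans ji).
Qed.

Lemma hessenberg_upper (U H : 'M[R]_n) :
  upper_pos_mx U -> hessenberg_mx H -> hessenberg_mx (H *m U).
Proof.
move=> pU hH i j ji; rewrite mxE big1 // => k _.
have [jk|kj] := ltnP j k; first by rewrite (upper_pos_eq0 pU) ?mulr0.
by rewrite hH ?mul0r // (leq_ltn_trans _ ji).
Qed.

End Hessenberg.

(** * The bidiagonal matrix and the unipotent matrix that diagonalizes it *)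

Lemma ord_lo_or_max n (j : 'I_n.+1) : j = ord_max \/ exists k, j = ord_lo k.
Proof.
case: (unliftP ord_max j) => [k ->|->]; [right; exists k|by left].
by apply: val_inj; exact: lift_max.
Qed.

Section Bidiagonal.
Variables (R : realType) (n : nat).
Variables (lambda : 'I_n.+1 -> R) (p : 'S_n.+1).
Implicit Types (beta : 'rV[R]_n) (L T Q : 'M[R]_n.+1).

Local Notation d i := (lambda (p i)).
Local Notation D := (permdiag lambda p).

Lemma bidiagE beta i j : bidiag lambda p beta i j =
  d i *+ (i == j) + \sum_k beta 0 k *+ ((i == ord_hi k) && (j == ord_lo k)).
Proof.
rewrite !mxE; congr (_ + _); rewrite summxE; apply: eq_bigr => k _.
by rewrite !mxE mulr_natr.
Qed.

Lemma bidiag_lo beta i k : bidiag lambda p beta i (ord_lo k) =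
  d i *+ (i == ord_lo k) + beta 0 k *+ (i == ord_hi k).
Proof.
rewrite bidiagE (bigD1 k) //= eqxx andbT big1 ?addr0 // => l lk.
by rewrite -[ord_lo k == _]val_eqE /= val_eqE [k == l]eq_sym (negPf lk) andbF.
Qed.

Lemma bidiag_max beta i : bidiag lambda p beta i ord_max = d i *+ (i == ord_max).
Proof.
rewrite bidiagE big1 ?addr0 // => l _.
by rewrite -[ord_max == _]val_eqE /= gtn_eqF ?andbF.
Qed.

Lemma bidiag_sub beta k : bidiag lambda p beta (ord_hi k) (ord_lo k) = beta 0 k.
Proof.
by rewrite bidiag_lo eqxx -val_eqE /= /bump /= gtn_eqF ?add0r // add1n.
Qed.

Lemma bidiag_hessenberg beta : hessenberg_mx (bidiag lambda p beta).
Proof.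
move=> i j; have [->|[k ->]] := ord_lo_or_max j => /= ji.
  by have := ltn_ord i; rewrite ltnS leqNgt ltnW.
rewrite bidiag_lo -!val_eqE /= /bump /= add1n !gtn_eqF ?addr0 //.
by rewrite (ltn_trans _ ji).
Qed.

(** A lower triangular Hessenberg matrix has only two nonzero diagonals. *)
Lemma eq_bidiag (B : 'M[R]_n.+1) :
  is_trig_mx B -> hessenberg_mx B -> (forall i, B i i = d i) ->
  B = bidiag lambda p (\row_k B (ord_hi k) (ord_lo k)).
Proof.
move=> /is_trig_mxP tB hB dB; apply/matrixP => i j.
have [->|[k ->]] := ord_lo_or_max j.
  rewrite bidiag_max; have [->|im] := eqVneq i ord_max; first by rewrite dB.
  by rewrite tB //= ltn_neqAle leq_ord andbT.
rewrite bidiag_lo mxE; have [->|il] := eqVneq i (ord_lo k).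
  by rewrite dB -val_eqE /= /bump /= add1n ltn_eqF ?addr0.
have [->|ih] := eqVneq i (ord_hi k); first by rewrite add0r.
rewrite addr0; have [ik|ki] := ltnP i k; first by rewrite tB.
apply: hB => /=; rewrite ltn_neqAle; move: ih il ki.
rewrite -!val_eqE /= /bump /= add1n => ih il ki.
by rewrite eq_sym ih ltn_neqAle eq_sym il.
Qed.

Lemma sum_mulrb_eq m (F : 'I_m -> R) a : \sum_j F j *+ (j == a) = F a.
Proof.
by rewrite (bigD1 a) //= eqxx big1 ?addr0 // => j /negPf ->.
Qed.

Lemma mul_bidiag_lo beta (A : 'M[R]_n.+1) i k :
  (A *m bidiag lambda p beta) i (ord_lo k) =
  A i (ord_lo k) * d (ord_lo k) + A i (ord_hi k) * beta 0 k.
Proof.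
rewrite mxE; under eq_bigr do rewrite bidiag_lo mulrDr !mulrnAr.
by rewrite big_split /= !sum_mulrb_eq.
Qed.

Lemma mul_bidiag_max beta (A : 'M[R]_n.+1) i :
  (A *m bidiag lambda p beta) i ord_max = A i ord_max * d ord_max.
Proof.
rewrite mxE; under eq_bigr do rewrite bidiag_max mulrnAr.
by rewrite sum_mulrb_eq.
Qed.

(** [D L = L B] read columnwise: a first order recurrence along each row of
    [L], which determines the row from its diagonal entry. *)
Lemma intertwineP beta L :
  D *m L = L *m bidiag lambda p beta <->
  (forall i k, (d i - d (ord_lo k)) * L i (ord_lo k) = L i (ord_hi k) * beta 0 k)
  /\ (forall i, (d i - d ord_max) * L i ord_max = 0).
Proof.
have DE i j : (D *m L) i j = d i * L i j by rewrite mul_diag_mx !mxE.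
split=> [E|[Elo Emax]].
  split=> [i k|i]; rewrite mulrBl -DE E.
    by rewrite mul_bidiag_lo [d _ * _]mulrC addrAC subrr add0r.
  by rewrite mul_bidiag_max mulrC subrr.
apply/matrixP => i j; rewrite DE; have [->|[k ->]] := ord_lo_or_max j.
  by apply/eqP; rewrite mul_bidiag_max -subr_eq0 [L _ _ * _]mulrC -mulrBl Emax.
by rewrite mul_bidiag_lo -Elo mulrBl [L _ _ * _]mulrC addrC subrK.
Qed.

Lemma conj_intertwine beta L : lower_unit_mx L ->
  invmx L *m D *m L = bidiag lambda p beta <->
  D *m L = L *m bidiag lambda p beta.
Proof.
move=> /lower_unit_unitmx uL; split=> [<-|E]; first by rewrite !mulmxA mulmxV ?mul1mx.
by rewrite -mulmxA E mulKmx.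
Qed.

(** Conjugation by [diag(e)]. *)
Definition scale_mx (e : 'I_n.+1 -> R) L : 'M[R]_n.+1 :=
  \matrix_(i, j) (e i * L i j / e j).

Definition scale_coord (e : 'I_n.+1 -> R) beta : 'rV[R]_n :=
  \row_k (e (ord_hi k) / e (ord_lo k) * beta 0 k).

Lemma scale_lower_unit e L :
  (forall i, e i != 0) -> lower_unit_mx L -> lower_unit_mx (scale_mx e L).
Proof.
move=> e0 [tL dL]; split=> [|i]; last by rewrite mxE dL mulr1 divff.
by apply/is_trig_mxP => i j ij; rewrite mxE (is_trig_mxP tL) // mulr0 mul0r.
Qed.

(** Since [diag(e)] commutes with [D], conjugating by it the relation
    [D L = L B] conjugates [B], which multiplies its subdiagonal entries by the
    ratios of consecutive entries of [e]. *)
Lemma scale_intertwine e beta L : (forall i, e i != 0) ->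
  D *m L = L *m bidiag lambda p beta ->
  D *m scale_mx e L = scale_mx e L *m bidiag lambda p (scale_coord e beta).
Proof.
move=> e0 /intertwineP[Elo Emax]; apply/intertwineP; split=> [i k|i]; rewrite !mxE.
  transitivity (e i / e (ord_lo k) * (L i (ord_hi k) * beta 0 k)).
    by rewrite -Elo; ring.
  by field; rewrite !e0.
transitivity (e i / e ord_max * ((d i - d ord_max) * L i ord_max)); first by ring.
by rewrite Emax mulr0.
Qed.

Hypothesis lambda_inj : injective lambda.

Let d_neq i j : i != j -> d i - d j != 0.
Proof. by move=> ij; rewrite subr_eq0; apply: contraNneq ij => /lambda_inj/perm_inj->. Qed.

Lemma intertwine_unique beta L L' : lower_unit_mx L -> lower_unit_mx L' ->
  D *m L = L *m bidiag lambda p beta -> D *m L' = L' *m bidiag lambda p beta ->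
  L = L'.
Proof.
move=> [tL dL] [tL' dL'] /intertwineP[E _] /intertwineP[E' _].
apply/matrixP => i j; have [m] := ubnP (i - j); elim: m j => // m IH j ijm.
have [ij|ji|/val_inj<-] := ltngtP i j; last by rewrite dL dL'.
  by rewrite (is_trig_mxP tL) // (is_trig_mxP tL').
have [jm|[k jk]] := ord_lo_or_max j.
  by move: ji; rewrite jm ltnNge -ltnS ltn_ord.
rewrite jk in ji ijm *; apply: (mulfI (d_neq (j := ord_lo k) (i := i) _)).
  by rewrite -val_eqE gtn_eqF.
rewrite E E' IH //= /bump /= add1n subnS.
by move: ji ijm => /= ji; rewrite ltnS => /(leq_trans _) -> //; rewrite prednK ?subn_gt0.
Qed.

(** The recurrence is solved by the products of [beta_k / (d_i - d_k)] over
    [j <= k < i]. *)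
Lemma intertwine_exists beta : exists2 L,
  lower_unit_mx L & D *m L = L *m bidiag lambda p beta.
Proof.
pose L : 'M[R]_n.+1 := \matrix_(i, j) if (j <= i)%N then
  \prod_(k < n | (j <= k < i)%N) (beta 0 k / (d i - d (ord_lo k))) else 0.
have LE i j : L i j = if (j <= i)%N then
  \prod_(k < n | (j <= k < i)%N) (beta 0 k / (d i - d (ord_lo k))) else 0.
  by rewrite mxE.
have L1 i : L i i = 1.
  by rewrite LE leqnn big1 // => k /andP[/leq_ltn_trans h /h]; rewrite ltnn.
have L0 (i j : 'I_n.+1) : (i < j)%N -> L i j = 0 by rewrite LE ltnNge => /negPf ->.
exists L; first by split=> //; apply/is_trig_mxP.
apply/intertwineP; split=> [i k|i].
  have [ik|ki|ik] := ltngtP (ord_lo k) i; first last.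
  - by rewrite -(val_inj ik) subrr mul0r L0 ?mul0r //= /bump /= add1n.
  - by rewrite !L0 ?mulr0 ?mul0r //= /bump /= add1n ltnS ltnW.
  rewrite !LE /= /bump /= add1n (ltnW ik) ik (bigD1 k) /=; last by rewrite leqnn.
  rewrite mulrA [X in X * _]mulrC divfK; last by rewrite d_neq // -val_eqE gtn_eqF.
  rewrite mulrC; congr (_ * _); apply: eq_bigl => l.
  rewrite -andbA [(l < i)%N && _]andbC andbA; congr (_ && _).
  by rewrite [RHS]ltn_neqAle andbC eq_sym -val_eqE.
have [->|im] := eqVneq i ord_max; first by rewrite subrr mul0r.
by rewrite L0 ?mulr0 //= ltn_neqAle leq_ord andbT.
Qed.

Lemma LpiP beta : lower_unit_mx (Lpi lambda p beta) /\
  D *m Lpi lambda p beta = Lpi lambda p beta *m bidiag lambda p beta.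
Proof.
have [|uL E] := xgetPex (0 : 'M[R]_n.+1)
    (P := [set L | lower_unit_mx L /\ invmx L *m D *m L = bidiag lambda p beta]).
  by have [L uL E] := intertwine_exists beta; exists L; split=> //; exact/conj_intertwine.
by split=> //; exact/conj_intertwine.
Qed.

Lemma Lpi_eq beta L : lower_unit_mx L ->
  D *m L = L *m bidiag lambda p beta -> Lpi lambda p beta = L.
Proof. by move=> uL; have [uL' E'] := LpiP beta; exact: intertwine_unique. Qed.

End Bidiagonal.

(** * Bidiagonal coordinates and the QR step *)

Section Charts.
Variables (R : realType) (n : nat).
Variables (lambda : 'I_n.+1 -> R) (p : 'S_n.+1).
Hypothesis lambda_inj : injective lambda.
Implicit Types (beta : 'rV[R]_n) (T Q U : 'M[R]_n.+1).

Local Notation d i := (lambda (p i)).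
Local Notation D := (permdiag lambda p).

(** Two orthogonal diagonalizations of [T] by [D] differ by a matrix commuting
    with [D], hence diagonal; LU-positivity forces its entries to be
    positive, and orthogonality then forces them to be [1]. *)
Lemma Qpi_unique T Q Q' :
  is_Qpi lambda p T Q -> is_Qpi lambda p T Q' -> Q = Q'.
Proof.
move=> [oQ [L [uL [U [pU QE]]]] TE] [oQ' [L' [uL' [U' [pU' QE']]]] TE'].
have [W oW Q'W] : exists2 W, orthogonal_mx W & Q' = W *m Q.
  exists (Q' *m Q^T); first exact/orthogonal_mxM/orthogonal_mxT.
  by rewrite -mulmxA oQ mulmx1.
have DW : D *m W = W *m D.
  have := TE'; rewrite TE Q'W trmx_mul => E.
  have := congr1 (fun A => W *m (Q *m A *m Q^T)) E; rewrite /= -!mulmxA.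
  rewrite orthogonal_mxV // mulmx1 [Q *m (Q^T *m _)]mulmxA orthogonal_mxV // mul1mx.
  rewrite [Q *m (Q^T *m _)]mulmxA orthogonal_mxV // mul1mx mulmx1.
  by rewrite [W *m (W^T *m _)]mulmxA orthogonal_mxV // mul1mx => ->.
have WE : W = diag_mx (\row_i W i i).
  apply/matrixP => i j; rewrite !mxE; have [->//|ij] := eqVneq i j.
  move: DW; rewrite mul_diag_mx mul_mx_diag => /matrixP/(_ i j).
  rewrite !mxE [RHS]mulrC => /eqP; rewrite -subr_eq0 -mulrBl mulf_eq0 subr_eq0.
  by case/orP=> [/eqP/lambda_inj/perm_inj/eqP|/eqP//]; rewrite (negPf ij).
suff W1 : W = 1%:M by rewrite Q'W W1 mul1mx.
apply: orthogonal_upper_pos_eq1 => //.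
have [|W0 _] := LU_sign (s := \row_i W i i) uL uL' pU pU'.
  by rewrite -mulmxA -QE -QE' -WE Q'W.
by rewrite WE; exact: upper_pos_diag.
Qed.

Lemma phiP beta : exists Q U, [/\ orthogonal_mx Q, upper_pos_mx U,
  Lpi lambda p beta = Q *m U & phi lambda p beta = Q^T *m D *m Q].
Proof.
have [uL _] := LpiP p lambda_inj beta.
have [Q [U [oQ pU E]]] := QR_exists (lower_unit_unitmx uL).
by exists Q, U; split=> //; rewrite /phi E Qfactor_eq.
Qed.

Lemma conj_bidiag beta Q U : orthogonal_mx Q -> Lpi lambda p beta = Q *m U ->
  Q^T *m D *m Q *m U = U *m bidiag lambda p beta.
Proof.
move=> oQ E; have [_] := LpiP p lambda_inj beta; rewrite E => DE.
by rewrite -mulmxA -(mulmxA Q^T) DE !mulmxA oQ mul1mx.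
Qed.

Lemma is_Qpi_phi beta : is_Qpi lambda p (phi lambda p beta)
  (Qfactor (Lpi lambda p beta)).
Proof.
have [Q [U [oQ pU E TE]]] := phiP beta; have [uL _] := LpiP p lambda_inj beta.
split=> //; rewrite E Qfactor_eq //.
exists (Lpi lambda p beta); split=> //; exists (invmx U); split.
  exact: upper_posV.
by rewrite E mulmxK // upper_pos_unitmx.
Qed.

(** [phi beta] is conjugate to the bidiagonal matrix by an upper triangular
    matrix, so it is Hessenberg; being symmetric, it is tridiagonal. *)
Lemma phi_chart beta : chart_domain lambda p (phi lambda p beta).
Proof.
split; last by exists (Qfactor (Lpi lambda p beta)); exact: is_Qpi_phi.
have [Q [U [oQ pU E TE]]] := phiP beta.
have symT : (phi lambda p beta)^T = phi lambda p beta.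
  by rewrite TE !trmx_mul trmxK tr_diag_mx mulmxA.
have hT : hessenberg_mx (phi lambda p beta).
  rewrite -[phi _ _ _](mulmxK (upper_pos_unitmx pU)) {1}TE (conj_bidiag oQ E).
  by apply: hessenberg_upper (upper_posV pU) _;
    exact/upper_hessenberg/bidiag_hessenberg.
split=> //.
- by move=> i j /orP[ij|/hT//]; rewrite -symT mxE hT.
- have oP : orthogonal_mx (perm_mx p : 'M[R]_n.+1)^T.
    rewrite /orthogonal_mx trmxK -row_permE; apply/matrixP => i j; rewrite !mxE (inj_eq perm_inj).
    by rewrite eq_sym.
  have oPQ := orthogonal_mxM oP oQ; have [_ uPQ] := mulmx1_unit oPQ.
  (* The permutation matrix reorders [D] into the diagonal matrix of [lambda]. *)
  exists ((perm_mx p)^T *m Q) => //.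
  have -> : invmx ((perm_mx p)^T *m Q) = ((perm_mx p)^T *m Q)^T.
    by rewrite -[RHS](mulmxK uPQ) oPQ mul1mx.
  rewrite TE trmx_mul trmxK -!mulmxA; congr (_ *m _); rewrite !mulmxA.
  congr (_ *m _); rewrite tr_perm_mx -row_permE -col_permE.
  by apply/matrixP => i j; rewrite !mxE (inj_eq perm_inj).
Qed.

Lemma psi_phi beta : psi lambda p (phi lambda p beta) = beta.
Proof.
have [Q [U [oQ pU E TE]]] := phiP beta; have [uL DL] := LpiP p lambda_inj beta.
have QpiE : Qpi lambda p (phi lambda p beta) = Q.
  rewrite -(Qfactor_eq oQ pU) -E; apply: xget_unique; first exact: is_Qpi_phi.
  by move=> Q' hQ'; apply: Qpi_unique hQ' _; exact: is_Qpi_phi.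
have QE : Q = Lpi lambda p beta *m invmx U.
  by rewrite E mulmxK // upper_pos_unitmx.
apply/rowP => k; rewrite mxE /Bpi QpiE QE Lfactor_eq //; last exact: upper_posV.
by rewrite ((conj_intertwine lambda p beta uL).2 DL) bidiag_sub.
Qed.

(** For [Q = L U], the matrix [L^-1 D L = U T U^-1] is lower triangular by its
    first expression and Hessenberg by its second, hence bidiagonal. *)
Lemma phi_psi T : chart_domain lambda p T -> phi lambda p (psi lambda p T) = T.
Proof.
move=> [[_ triT _] exQ].
have [oQ [L [uL [U [pU QE]]]] TE] : is_Qpi lambda p T (Qpi lambda p T).
  exact: (xgetPex 0 exQ).
have iU := upper_pos_unitmx pU.
have LE : Lfactor (Qpi lambda p T) = L by rewrite QE Lfactor_eq.
have L_eq : L = Qpi lambda p T *m invmx U by rewrite QE mulmxK.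
have BE : Bpi lambda p T = invmx L *m D *m L by rewrite /Bpi LE.
have BE' : Bpi lambda p T = U *m T *m invmx U.
  apply: (canRL (mulmxK iU)); rewrite BE -!mulmxA.
  apply: (canLR (mulKmx (lower_unit_unitmx uL))).
  by rewrite [RHS]mulmxA -QE {3}TE !mulmxA orthogonal_mxV // mul1mx.
have [tL dL] := uL; have L0 i := lower_unit_neq0 i uL.
have BB : Bpi lambda p T = bidiag lambda p (psi lambda p T).
  apply: eq_bidiag.
  - by rewrite BE !mul_trig ?inv_trig ?diag_mx_is_trig.
  - rewrite BE'; apply: hessenberg_upper; first exact: upper_posV.
    by apply: upper_hessenberg => // i j ij; rewrite triT // ij orbT.
  - move=> i; rewrite BE !mul_trig_diag ?mul_trig ?inv_trig ?diag_mx_is_trig //.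
    by rewrite inv_trig_diag // dL invr1 mul1r mulr1 !mxE eqxx mulr1n.
have DL : D *m L = L *m bidiag lambda p (psi lambda p T).
  by apply/(conj_intertwine lambda p _ uL); rewrite -BE.
rewrite /phi (Lpi_eq lambda_inj uL DL) L_eq Qfactor_eq //; exact: upper_posV.
Qed.

Variables (f : R -> R) (f_neq0 : forall i, f (lambda i) != 0).

Let e i := `|f (d i)|.
Let e_neq0 i : e i != 0. Proof. by rewrite normr_eq0. Qed.

(** Write [f(D) = S |f(D)|] with [S] a diagonal matrix of signs, [L = Q U] and
    [L' = |f(D)| L |f(D)|^-1 = Q' U'].  Then
    [f(T) = Q^T f(D) L U^-1 = (Q^T S Q') (U' |f(D)| U^-1)] is the QR
    factorization of [f(T)], and the step conjugates [T = Q^T D Q] into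
    [Q'^T S D S Q' = Q'^T D Q']. *)
Lemma QRstep_phi beta :
  QRstep f (phi lambda p beta) = phi lambda p (scale_coord e beta).
Proof.
have [Q [U [oQ pU E TE]]] := phiP beta.
have [Q' [U' [oQ' pU' E' TE']]] := phiP (scale_coord e beta).
have [uL DL] := LpiP p lambda_inj beta.
have L'E : Lpi lambda p (scale_coord e beta) = scale_mx e (Lpi lambda p beta).
  by apply: Lpi_eq => //; [exact: scale_lower_unit|exact: scale_intertwine].
pose S : 'M[R]_n.+1 := diag_mx (\row_i Num.sg (f (d i))).
have fd0 i : f (d i) != 0 by exact: f_neq0.
have SS : S *m S = 1%:M.
  apply/matrixP => i j; rewrite mul_diag_mx !mxE; case: (i == j); rewrite ?mulr0 //.
  by rewrite mulr1n -expr2 sqr_sg fd0.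
have oS : orthogonal_mx S by rewrite /orthogonal_mx tr_diag_mx.
have SDS : S *m D *m S = D.
  by rewrite diag_mxC -mulmxA SS mulmx1.
have oO : orthogonal_mx (Q^T *m S *m Q').
  by do ?apply: orthogonal_mxM => //; exact: orthogonal_mxT.
have Qf : Qfactor (funcalc f (phi lambda p beta)) = Q^T *m S *m Q'.
  rewrite TE funcalcE //.
  have fDL : diag_mx (map_mx f (\row_i d i)) *m Lpi lambda p beta =
      S *m (Q' *m U') *m diag_mx (\row_i e i).
    rewrite -E' L'E mul_mx_diag !mul_diag_mx; apply/matrixP => i j; rewrite !mxE.
    by rewrite {1}[f (d i)]numEsg -!mulrA mulVf // mulr1.
  have QE : Q = Lpi lambda p beta *m invmx U.
    by rewrite E mulmxK // upper_pos_unitmx.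
  rewrite {2}QE mulmxA -(mulmxA _ _ (Lpi _ _ _)) fDL.
  rewrite -[RHS](@Qfactor_eq _ _ _ (U' *m diag_mx (\row_i e i) *m invmx U)) //.
    by rewrite !mulmxA.
  apply: upper_posM; last exact: upper_posV.
  by apply: upper_posM => //; apply: upper_pos_diag => i; rewrite mxE normr_gt0.
rewrite /QRstep Qf TE TE' !trmx_mul trmxK tr_diag_mx -!mulmxA.
rewrite [Q *m (Q^T *m (S *m _))]mulmxA orthogonal_mxV // mul1mx.
rewrite [Q *m (Q^T *m (D *m _))]mulmxA orthogonal_mxV // mul1mx.
by rewrite [D *m (S *m _)]mulmxA [S *m (D *m S *m _)]mulmxA [S *m (D *m S)]mulmxA SDS.
Qed.

Lemma iter_QRstep_phi k beta : iter k (QRstep f) (phi lambda p beta) =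
  phi lambda p (scale_coord (fun i => e i ^+ k) beta).
Proof.
elim: k => [|k IH] /=.
  by congr phi; apply/rowP => i; rewrite mxE !expr0 divr1 mul1r.
rewrite IH QRstep_phi; congr phi; apply/rowP => i; rewrite !mxE.
by rewrite mulrA mulrACA -!exprS -invfM -exprS.
Qed.

End Charts.

(** * Convergence *)

Section Convergence.
Variable R : realType.

Lemma cvg_mxP m n (u : nat -> 'M[R]_(m, n)) (A : 'M[R]_(m, n)) :
  u @ \oo --> A <-> forall i j, (fun k => u k i j) @ \oo --> A i j.
Proof.
split=> [uA i j B AB|uA B [P AP PB]].
  apply: (uA [set N : 'M[R]_(m, n) | B (N i j)]).
  (* The neighborhood of matrices constrains only the entry [(i, j)]. *)
  exists (fun i' j' => [set x | i' = i -> j' = j -> B x]); last by move=> N; exact.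
  move=> i' j'; have [->|ii'] := eqVneq i' i; last first.
    by apply: filterS filterT => x _ /= /eqP; rewrite (negPf ii').
  have [->|jj'] := eqVneq j' j; first by apply: filterS AB => x Bx.
  by apply: filterS filterT => x _ /= _ /eqP; rewrite (negPf jj').
have uP (ij : 'I_m * 'I_n) : \forall k \near \oo, P ij.1 ij.2 (u k ij.1 ij.2).
  exact: (uA ij.1 ij.2).
have uPB : \forall k \near \oo, B (u k).
  apply: filterS (filter_forall _ uP) => k uk; apply: PB => i j.
  exact: (uk (i, j)).
exact: uPB.
Qed.

Lemma cvg_sumr (I : Type) (r : seq I) (P : pred I) (u : I -> nat -> R) (a : I -> R) :
  (forall i, P i -> u i @ \oo --> a i) ->
  (fun k => \sum_(i <- r | P i) u i k) @ \oo --> \sum_(i <- r | P i) a i.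
Proof. by move=> ua; apply: cvg_big => //; exact: add_continuous. Qed.

Lemma cvg_sumr0 (I : Type) (r : seq I) (P : pred I) (u : I -> nat -> R) :
  (forall i, P i -> u i @ \oo --> (0 : R)) ->
  (fun k => \sum_(i <- r | P i) u i k) @ \oo --> (0 : R).
Proof.
by move=> /(@cvg_sumr I r P u (fun=> 0)); rewrite [X in _ --> X]big1.
Qed.

Lemma cvg_mulmx m n q (u : nat -> 'M[R]_(m, n)) (v : nat -> 'M[R]_(n, q))
    (A : 'M[R]_(m, n)) (B : 'M[R]_(n, q)) :
  u @ \oo --> A -> v @ \oo --> B -> (fun k => u k *m v k) @ \oo --> A *m B.
Proof.
move=> /cvg_mxP uA /cvg_mxP vB; apply/cvg_mxP => i j; rewrite mxE.
under eq_fun do rewrite mxE.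
by apply: cvg_sumr => l _; exact: cvgM.
Qed.

Lemma cvg_trmx m n (u : nat -> 'M[R]_(m, n)) (A : 'M[R]_(m, n)) :
  u @ \oo --> A -> (fun k => (u k)^T) @ \oo --> A^T.
Proof.
move=> /cvg_mxP uA; apply/cvg_mxP => i j; rewrite mxE.
by under eq_fun do rewrite mxE; exact: uA.
Qed.

(** Continuity of the Cholesky factor at the identity.  Row [i] of [U] is
    computed from the rows above it, which converge by induction, through
    [U i i * U i j = G i j - \sum_(l < i) U l i * U l j], where [G = U^T U];
    positivity selects the root in [U i i ^+ 2 --> 1]. *)
Lemma cvg_cholesky1 n (U : nat -> 'M[R]_n) :
  (forall k, upper_pos_mx (U k)) ->
  (fun k => (U k)^T *m U k) @ \oo --> (1%:M : 'M[R]_n) ->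
  U @ \oo --> (1%:M : 'M[R]_n).
Proof.
move=> pU /cvg_mxP cG; apply/cvg_mxP => i.
have [m] := ubnP (val i); elim: m i => // m IH i im.
have prodE j : (fun k => U k i i * U k i j) =
    (fun k => ((U k)^T *m U k) i j - \sum_(l | l != i) U k l i * U k l j).
  apply/funext => k; rewrite mxE (bigD1 i) //= mxE.
  by under eq_bigr do rewrite mxE; rewrite addrK.
have prod_cvg j : (fun k => U k i i * U k i j) @ \oo --> (1%:M : 'M[R]_n) i j.
  rewrite prodE -[_ i j]subr0; apply: cvgB; first exact: cG.
  apply: cvg_sumr0 => l li; have [il|li'|/val_inj il] := ltngtP i l.
  - under eq_fun do rewrite upper_pos_eq0 // mul0r.
    exact: cvg_cst.
  - have lm : (l < m)%N by exact: leq_trans li' _.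
    have -> : 0 = (1%:M : 'M[R]_n) l i * (1%:M : 'M[R]_n) l j.
      by rewrite mxE (negPf li) mul0r.
    by apply: cvgM; exact: IH.
  - by rewrite il eqxx in li.
have diag_cvg : (fun k => U k i i) @ \oo --> (1 : R).
  have -> : (fun k => U k i i) = (fun k => Num.sqrt (U k i i * U k i i)).
    apply/funext => k; rewrite -expr2 sqrtr_sqr gtr0_norm //.
    by have [_] := pU k.
  rewrite -sqrtr1; have := prod_cvg i; rewrite mxE eqxx => h.
  exact: (cvg_comp _ _ h (@sqrt_continuous R 1)).
move=> j; have -> : (fun k => U k i j) = (fun k => (U k i i)^-1 * (U k i i * U k i j)).
  apply/funext => k; rewrite mulKf // gt_eqF //.
  by have [_] := pU k.
rewrite -[_ i j]mul1r -[X in X * _]invr1; apply: cvgM; last exact: prod_cvg.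
by apply: cvgV; rewrite ?oner_neq0.
Qed.

(** Continuity of the QR factorization at the identity: [U^T U = M^T M] gives
    the limit of [U], and [Q = M - Q (U - 1)] that of [Q], the entries of [Q]
    being bounded. *)
Lemma cvg_QR1 n (M Q U : nat -> 'M[R]_n) :
  (forall k, orthogonal_mx (Q k)) -> (forall k, upper_pos_mx (U k)) ->
  (forall k, M k = Q k *m U k) -> M @ \oo --> (1%:M : 'M[R]_n) ->
  Q @ \oo --> (1%:M : 'M[R]_n) /\ U @ \oo --> (1%:M : 'M[R]_n).
Proof.
move=> oQ pU ME cM.
have cU : U @ \oo --> (1%:M : 'M[R]_n).
  apply: cvg_cholesky1 => //.
  have -> : (fun k => (U k)^T *m U k) = (fun k => (M k)^T *m M k).
    apply/funext => k; rewrite ME trmx_mul !mulmxA -(mulmxA _ (Q k)^T).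
    by rewrite oQ mulmx1.
  rewrite -[X in _ --> X]mulmx1; apply: cvg_mulmx => //.
  by rewrite -[X in _ --> X]trmx1; exact: cvg_trmx.
split=> //; apply/cvg_mxP => i j.
have -> : (fun k => Q k i j) =
    (fun k => M k i j - \sum_l Q k i l * (U k l j - (1%:M : 'M[R]_n) l j)).
  apply/funext => k; have -> : \sum_l Q k i l * (U k l j - (1%:M : 'M[R]_n) l j) =
      (Q k *m (U k - 1%:M)) i j by rewrite mxE; apply: eq_bigr => l _; rewrite !mxE.
  by rewrite mulmxBr mulmx1 -ME !mxE opprB addrCA subrr addr0.
rewrite -[X in _ --> X]subr0; apply: cvgB; first by move/cvg_mxP: cM; exact.
apply: cvg_sumr0 => l _; apply: norm_cvg0.
have cUl : (fun k => `|U k l j - (1%:M : 'M[R]_n) l j|) @ \oo --> (0 : R).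
  apply/norm_cvg0P; rewrite -(subrr ((1%:M : 'M[R]_n) l j)).
  by apply: cvgB; [move/cvg_mxP: cU; exact|exact: cvg_cst].
apply: (squeeze_cvgr _ (cvg_cst 0) cUl); apply: nearW => k.
by rewrite normr_ge0 normrM ler_piMl // orthogonal_entry_le1.
Qed.

End Convergence.

Section Asymptotics.
Variables (R : realType) (n : nat).
Variables (lambda : 'I_n.+1 -> R) (p : 'S_n.+1).
Hypothesis lambda_inj : injective lambda.

Local Notation D := (permdiag lambda p).

Lemma decr_chain (e : 'I_n.+1 -> R) :
  (forall k, e (ord_hi k) < e (ord_lo k)) ->
  forall i j : 'I_n.+1, (j < i)%N -> e i < e j.
Proof.
move=> e_lt i; have [m] := ubnP (val i); elim: m i => // m IH i im j ji.
case: (unliftP ord0 i) => [k|] iE; last by rewrite iE in ji.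
have ihi : i = ord_hi k by [].
rewrite ihi in im ji *; move: ji im; rewrite /= /bump /= add1n ltnS => jk im.
have [jlo|jlo] := eqVneq j (ord_lo k); first by rewrite jlo.
apply: lt_trans (e_lt k) _; apply: IH => //=.
by rewrite ltn_neqAle jk andbT; exact: jlo.
Qed.

(** Conjugation by powers of a decreasing positive diagonal contracts the
    strictly lower triangular part. *)
Lemma cvg_scale_mx (e : 'I_n.+1 -> R) (L : 'M[R]_n.+1) :
  (forall i, 0 < e i) -> (forall k, e (ord_hi k) < e (ord_lo k)) ->
  lower_unit_mx L ->
  (fun k => scale_mx (fun i => e i ^+ k) L) @ \oo --> (1%:M : 'M[R]_n.+1).
Proof.
move=> e0 e_lt [tL dL]; apply/cvg_mxP => i j.
have -> : (fun k => scale_mx (fun i => e i ^+ k) L i j) =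
    (fun k => L i j * (e i / e j) ^+ k).
  by apply/funext => k; rewrite mxE exprMn exprVn mulrAC mulrC mulrA.
rewrite mxE; have [ij|ij|/val_inj <-] := ltngtP i j.
- rewrite (is_trig_mxP tL) // -val_eqE ltn_eqF //.
  by under eq_fun do rewrite mul0r; exact: cvg_cst.
- rewrite -val_eqE gtn_eqF // mulr0n -(mulr0 (L i j)); apply: cvgM; first exact: cvg_cst.
  apply: cvg_expr; rewrite ger0_norm ?divr_ge0 ?ltW //.
  by rewrite ltr_pdivrMr // mul1r; exact: decr_chain.
- rewrite eqxx; under eq_fun do rewrite dL mul1r divff ?gt_eqF // expr1n.
  exact: cvg_cst.
Qed.

(** Entry [(k + 1, k)] of [T U = U B], where [T] and [B] are Hessenberg and [U]
    is upper triangular. *)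
Lemma phi_sub beta (Q U : 'M[R]_n.+1) k :
  orthogonal_mx Q -> upper_pos_mx U -> Lpi lambda p beta = Q *m U ->
  phi lambda p beta = Q^T *m D *m Q ->
  phi lambda p beta (ord_hi k) (ord_lo k) * U (ord_lo k) (ord_lo k) =
  U (ord_hi k) (ord_hi k) * beta 0 k.
Proof.
move=> oQ pU LE TE; have := conj_bidiag lambda_inj oQ LE.
rewrite -TE => /matrixP/(_ (ord_hi k) (ord_lo k)).
rewrite mul_bidiag_lo (upper_pos_eq0 pU (i := ord_hi k)) ?mul0r ?add0r; last first.
  by rewrite /= /bump /= add1n.
move=> <-; rewrite [RHS]mxE (bigD1 (ord_lo k)) //= big1 ?addr0 // => l lk.
have [kl|lk'|/val_inj kl] := ltngtP (ord_lo k) l.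
- by rewrite [U _ _](upper_pos_eq0 pU) ?mulr0.
- have [[_ triT _] _] := phi_chart p lambda_inj beta.
  by rewrite triT ?mul0r // orbC /= /bump /= add1n ltnS lk'.
- by rewrite kl eqxx in lk.
Qed.

Variables (f : R -> R) (f_neq0 : forall i, f (lambda i) != 0).
Hypothesis f_decr : forall i : 'I_n,
  `|f (lambda (p (ord_hi i)))| < `|f (lambda (p (ord_lo i)))|.

Lemma iter_QRstep_cvg beta :
  ((fun k => iter k (QRstep f) (phi lambda p beta)) @ \oo --> D) /\
  (forall i : 'I_n, (fun k => iter k (QRstep f) (phi lambda p beta)
      (ord_hi i) (ord_lo i)
      * `|f (lambda (p (ord_lo i))) / f (lambda (p (ord_hi i)))| ^+ k)
    @ \oo --> beta 0 i).
Proof.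
pose e i := `|f (lambda (p i))|.
have e_gt0 i : 0 < e i by rewrite normr_gt0.
have ek_neq0 k i : e i ^+ k != 0 by rewrite expf_neq0 // gt_eqF.
pose b k := scale_coord (fun i => e i ^+ k) beta.
have /boolp.choice[QU QUP] : forall k, exists QU : 'M[R]_n.+1 * 'M[R]_n.+1,
    [/\ orthogonal_mx QU.1, upper_pos_mx QU.2, Lpi lambda p (b k) = QU.1 *m QU.2 &
      phi lambda p (b k) = QU.1^T *m D *m QU.1].
  by move=> k; have [Q [U H]] := phiP p lambda_inj (b k); exists (Q, U).
have [uL DL] := LpiP p lambda_inj beta.
have LE k : Lpi lambda p (b k) = scale_mx (fun i => e i ^+ k) (Lpi lambda p beta).
  by apply: Lpi_eq => //; [exact: scale_lower_unit|exact: scale_intertwine].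
have [cQ cU] : (fun k => (QU k).1) @ \oo --> (1%:M : 'M[R]_n.+1) /\
    (fun k => (QU k).2) @ \oo --> (1%:M : 'M[R]_n.+1).
  apply: (@cvg_QR1 _ _ (fun k => Lpi lambda p (b k))).
  - by move=> k; have [] := QUP k.
  - by move=> k; have [] := QUP k.
  - by move=> k; have [] := QUP k.
  - rewrite (_ : (fun k => _) = fun k => scale_mx (fun i => e i ^+ k) (Lpi lambda p beta)).
      exact: cvg_scale_mx.
    exact/funext.
have iterE k : iter k (QRstep f) (phi lambda p beta) = phi lambda p (b k).
  exact: iter_QRstep_phi.
split=> [|i].
  rewrite (_ : (fun k => _) = fun k => (QU k).1^T *m D *m (QU k).1); last first.
    by apply/funext => k; rewrite iterE; have [] := QUP k.
  have DE : D = 1%:M^T *m D *m 1%:M by rewrite trmx1 mul1mx mulmx1.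
  rewrite [X in _ --> X]DE.
  by apply: cvg_mulmx => //; apply: cvg_mulmx; [exact: cvg_trmx|exact: cvg_cst].
pose U k := (QU k).2.
have pU k : upper_pos_mx (U k) by have [] := QUP k.
rewrite (_ : (fun k => _) = fun k =>
    U k (ord_hi i) (ord_hi i) * (U k (ord_lo i) (ord_lo i))^-1 * beta 0 i).
  have betaE : beta 0 i = 1 * 1^-1 * beta 0 i by rewrite invr1 !mul1r.
  rewrite [X in _ --> X]betaE; apply: cvgM; last exact: cvg_cst.
  have cUi j : (fun k => U k j j) @ \oo --> (1 : R).
    by have /cvg_mxP/(_ j j) := cU; rewrite mxE eqxx.
  by apply: cvgM => //; apply: cvgV; rewrite ?oner_neq0.
apply/funext => k; rewrite iterE; have [oQ _ LQ TQ] := QUP k.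
have U0 : U k (ord_lo i) (ord_lo i) != 0 by rewrite gt_eqF //; have [_] := pU k.
have := phi_sub i oQ (pU k) LQ TQ => /(canRL (mulfK U0)) ->.
rewrite mxE normrM normfV -/(e _) -/(e _) exprMn exprVn.
have h1 := ek_neq0 k (ord_hi i); have h2 := ek_neq0 k (ord_lo i).
by rewrite /U; field; apply/and3P.
Qed.

End Asymptotics.

Theorem proposition4p1 (R : realType) (n : nat) (hn : (2 <= n.+1)%N)
  (lambda : 'I_n.+1 -> R)
  (hlambda : forall i j : 'I_n.+1, (i < j)%N -> lambda i < lambda j)
  (X : set R) (f : R -> R)
  (hXopen : open X) (hXlambda : forall i, X (lambda i))
  (hfcont : {within X, continuous f})
  (hf0 : forall i, f (lambda i) != 0)
  (p : 'S_n.+1) :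
  (forall beta : 'rV[R]_n,
     [/\ chart_domain lambda p (phi lambda p beta),
         chart_domain lambda p (QRstep f (phi lambda p beta)) &
         QRstep_chart lambda p f beta =
         \row_i (`|f (lambda (p (ord_hi i))) / f (lambda (p (ord_lo i)))|
                 * beta 0 i)])
  /\
  (forall (T : 'M[R]_n.+1) (beta : 'rV[R]_n),
     chart_domain lambda p T -> psi lambda p T = beta ->
     (forall i : 'I_n,
        `|f (lambda (p (ord_hi i)))| < `|f (lambda (p (ord_lo i)))|) ->
     ((fun k : nat => iter k (QRstep f) T) @ \oo --> permdiag lambda p)
     /\
     (forall i : 'I_n,
        (fun k : nat =>
           iter k (QRstep f) T (ord_hi i) (ord_lo i)
           * `|f (lambda (p (ord_lo i))) / f (lambda (p (ord_hi i)))| ^+ k)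
        @ \oo --> beta 0 i)).
Proof.
have lambda_inj : injective lambda.
  move=> i j ij; have [h|h|/val_inj//] := ltngtP i j.
    by have := hlambda _ _ h; rewrite ij ltxx.
  by have := hlambda _ _ h; rewrite ij ltxx.
split=> [beta|T beta chT <- f_decr].
  split; first exact: phi_chart.
    by rewrite QRstep_phi //; exact: phi_chart.
  rewrite /QRstep_chart /= QRstep_phi // psi_phi //.
  by apply/rowP => i; rewrite !mxE normf_div.
by have := iter_QRstep_cvg lambda_inj hf0 f_decr (psi lambda p T); rewrite phi_psi.
Qed.
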